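(* For every $\varepsilon>0$, triangle and simplex enumeration in sparse hypergraphs on $n$ vertices requires $\Omega(n^{1-\varepsilon})$ rounds in the PRIMAL CONGEST (PC) model.
   Context: A hypergraph $H=(V,E)$ has vertex set $V$, $|V|=n$, and a set $E$ of nonempty subsets of $V$. $H$ is sparse if $\sum_{e\in E}|e|=O(n)$ (i.e. at most $Cn$ for a constant $C$ independent of $n$). A triangle is a simple cycle of length three $(v_0,e_0,v_1,e_1,v_2,e_2)$: distinct vertices, distinct edges, $v_i\in e_{i-1}\cap e_i$ (indices mod $3$); it is induced if moreover $v_i\notin e_{i+1}$ for each $i$. An $r$-dimensional simplex is a set of $r+1$ vertices all of whose $r$-element subsets are edges. In the triangle (simplex) enumeration problem each vertex outputs a set of triangles (simplices) such that these sets are pairwise disjoint and their union is the set of all triangles (simplices) of $H$; the triangle result applies both to all triangles and to all induced triangles. Computation: vertices are nodes with unique $O(\log n)$-bit IDs; synchronous rounds with unbounded local computation; $B=\Theta(\log n)$; initially each vertex knows its ID and its incident edges, including the IDs of the vertices in them ($\mathrm{KT}_1$). In PC, in each round each vertex $v$ can send a distinct $B$-bit message to each vertex sharing an edge with $v$ (one per such vertex). *)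

(* Defs.v *)
From HB Require Import structures.
From mathcomp Require Import all_boot all_order all_algebra.
From mathcomp Require Import all_classical all_reals all_analysis.

Set Implicit Arguments.
Unset Strict Implicit.
Unset Printing Implicit Defensive.

Import Order.TTheory GRing.Theory Num.Theory.
Import numFieldNormedType.Exports.

Local Open Scope ring_scope.

(* A vertex is its own identifier: a hypergraph lives on a finite set [verts] *)
(* of elements of an identifier space [ID], whose other elements are unused.  *)
Record hypergraph (ID : finType) := Hypergraph {
  verts : {set ID};
  edges : {set {set ID}};
  edges_subset : forall e, e \in edges -> e \subset verts;
  edges_nonempty : forall e, e \in edges -> e != finset.set0
}.

Definition sparse (R : realType) (C : R) (ID : finType) (H : hypergraph ID) :=
  (\sum_(e in edges H) #|e|)%N%:R <= C * #|verts H|%:R.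

Section Objects.
Variable ID : finType.
Implicit Type H : hypergraph ID.

Definition incident H (v : ID) : {set {set ID}} := [set e in edges H | v \in e].

Definition adjacent H (u v : ID) : bool :=
  (u != v) && [exists e in edges H, (u \in e) && (v \in e)].

(* The sequence (v_0, e_0, v_1, e_1, v_2, e_2), as the pair (v, e).  The      *)
(* rotations and reflections of a triangle are separate sequences; a node can *)
(* pass locally between listing cycles and listing all their sequences.       *)
Definition cycle3 : finType := ({ffun 'I_3 -> ID} * {ffun 'I_3 -> {set ID}})%type.

(* Indices are computed in 'I_3, that is, modulo 3.                           *)
Definition triangles H : {set cycle3} :=
  [set t : cycle3 | [&& injectiveb t.1, injectiveb t.2,
     [forall i, t.1 i \in verts H], [forall i, t.2 i \in edges H] &
     [forall i, t.1 i \in t.2 (i - 1) :&: t.2 i]]].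

Definition induced_triangles H : {set cycle3} :=
  [set t in triangles H | [forall i, t.1 i \notin t.2 (i + 1)]].

Definition vertex_set : finType := {set ID}.

Definition is_simplex H (r : nat) (S : {set ID}) : bool :=
  [&& S \subset verts H, #|S| == r.+1 &
   [forall F : {set ID}, (F \subset S) && (#|F| == r) ==> (F \in edges H)]].

Definition simplices (r : nat) H : {set vertex_set} :=
  [set S : {set ID} | is_simplex H r S].

(* All simplices of dimension at least 2, the dimension of S being #|S| - 1.  *)
(* Dimension 1 is left out because two singleton edges span a 1-dimensional   *)
(* simplex even when no path connects them, so that those simplices cannot be *)
(* enumerated in any number of rounds.                                        *)
Definition all_simplices H : {set vertex_set} :=
  [set S : {set ID} | (2 < #|S|)%N && is_simplex H #|S|.-1 S].

End Objects.

(* A synchronous algorithm whose messages have type [msg] and whose nodes     *)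
(* each output a set of elements of [out].  A node starts from its identifier *)
(* and its incident edges (KT_1) and addresses its neighbours by identifier;  *)
(* [None] stands for the absence of a message.  Local computation being       *)
(* unbounded, the state space and the transition functions are arbitrary.     *)
Record algorithm (ID msg out : finType) := Algorithm {
  state : Type;
  init : ID -> {set {set ID}} -> state;
  send : state -> ID -> option msg;
  receive : state -> (ID -> option msg) -> state;
  output : state -> {set out}
}.

Section Execution.
Variables (ID msg out : finType) (A : algorithm ID msg out) (H : hypergraph ID).

(* One round of PC: what v receives from u is what u addressed to v, provided *)
(* u and v share an edge.                                                     *)
Definition pc_round (s : ID -> state A) : ID -> state A :=
  fun v => receive (s v) (fun u => if adjacent H u v then send (s u) v else None).

Definition pc_run (T : nat) : ID -> state A :=
  iter T pc_round (fun v => init A v (incident H v)).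

Definition pc_output (T : nat) (v : ID) : {set out} := output (pc_run T v).

Definition pc_enumerates (T : nat) (X : {set out}) : Prop :=
  (forall u v, u \in verts H -> v \in verts H -> u != v ->
     [disjoint pc_output T u & pc_output T v]) /\
  (\bigcup_(v in verts H) pc_output T v)%SET = X.

End Execution.

Local Open Scope classical_set_scope.

(* The number of rounds [T n] of any algorithm for n-vertex hypergraphs of    *)
(* total edge size at most C n, with identifiers of [k n] bits and messages   *)
(* of [B n] bits, is Omega(g n).  The algorithm may depend on n; it has to    *)
(* work for every choice of the n identifiers.                                *)
Definition pc_enumeration_requires (R : realType) (C : R) (k B : nat -> nat)
    (out : finType -> finType)
    (problem : forall ID : finType, hypergraph ID -> {set out ID})
    (g : nat -> R) : Prop :=
  forall (T : nat -> nat)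
    (A : forall n, algorithm ((k n).-tuple bool) ((B n).-tuple bool)
                     (out ((k n).-tuple bool : finType))),
  (forall n (H : hypergraph ((k n).-tuple bool)),
     #|verts H| = n -> sparse C H -> pc_enumerates (A n) H (T n) (problem _ H)) ->
  ((fun n => (T n)%:R) : nat -> R^o) \is 'Omega_\oo (g : nat -> R^o).

(* Main.v *)
(* Fix a hypergraph G whose edges all lie in a small vertex set W, and let   *)
(* the input be its subhypergraph with edge set x, for an arbitrary set x of  *)
(* edges of G.  The objects o to be listed correspond to small sets F(o) of   *)
(* edges without common vertex, each edge lying in at most D of the F(o).     *)
(* What a node u outputs then reveals edges that do not contain u, at least   *)
(* one for every D objects, and u learns these only through the messages of   *)
(* the at most |W| nodes it shares an edge with: on average over x it infers  *)
(* at most |W| b T of them in T rounds of b-bit messages, and it infers none  *)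
(* if it is outside W.  As a random x retains a constant fraction of the      *)
(* objects, their number is O(D |W|^2 b T).                                   *)
(* For simplices, G consists of all r-subsets of W with |W| ~ n^(1/r), which  *)
(* gives about |W|^(r+1) objects and D <= |W|.  For triangles, v_0, v_1, v_2  *)
(* are fixed vertices, X_0, X_1, X_2 are disjoint sets of s ~ log n other     *)
(* vertices, and the edges are {v_i, v_(i+1)} together with any subset of     *)
(* X_i: one edge of each kind makes an induced triangle, so that there are    *)
(* 2^(3 s) objects and D = 2^(2 s).                                           *)

Require Import Defs.
From HB Require Import structures.
From mathcomp Require Import all_boot all_order all_algebra.
From mathcomp Require Import ring lra.

Set Implicit Arguments.
Unset Strict Implicit.
Unset Printing Implicit Defensive.

(** The bound is an information bottleneck averaged over the inputs [partial G x], with [x] a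
    uniformly random set of edges of [G]. Whatever a node asserts about edges that avoid it is paid
    for by the bits it receives: [sum_exp_inferred] bounds the mean of 2 to the number of inferred
    edges by an injective encoding, and the Jensen-type [sum_le_log] turns this into a bound on the
    mean number itself. Conversely, every present object is output somewhere, and [card_output]
    converts output objects into inferred edges at rate [D]. A fixed object survives in [x] with
    probability at least 2^(-c), so summing over the nodes gives [enumeration_bound].

    Both families of hypergraphs are then tuned by one parameter q: total size O(q^r), while only a
    factor O(q^3 b) is lost against the number of rounds ([simplices_hard], [triangles_hard]). With
    q^r of order n, the factor q^3 is at most n^(3/r) <= n^(eps/2) as soon as r >= 6/eps, and
    messages of O(log n) bits cost another O(n^(eps/2)); this is [hard_requires]. *)

(** * Averaging and counting tools *)

Lemma expn_log_le (p q : nat) : 2 ^ q * p.+1 <= 2 ^ q * q + 2 ^ p.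
Proof.
have [lt_pq | le_qp] := ltnP p q.
  by rewrite (leq_trans _ (leq_addr _ _)) // leq_mul2l lt_pq orbT.
rewrite -(subnKC le_qp); move: (p - q) => d.
by rewrite expnD -mulnDr leq_mul2l -addnS leq_add2l ltn_expl ?orbT.
Qed.

(** Jensen's inequality for the logarithm, kept in [nat]: sum over [X] the integer tangent-line
    bound 2^p >= 2^q (p + 1 - q) of [expn_log_le]. *)
Lemma sum_le_log (I : finType) (X : {set I}) (P : I -> nat) (q : nat) :
  \sum_(i in X) 2 ^ P i <= 2 ^ q * #|X| -> \sum_(i in X) P i <= q * #|X|.
Proof.
move=> le_exp; rewrite -(@leq_pmul2l (2 ^ q)) ?expn_gt0 //.
rewrite -(leq_add2r (2 ^ q * #|X|)).
have -> : 2 ^ q * (\sum_(i in X) P i) + 2 ^ q * #|X| =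
          \sum_(i in X) 2 ^ q * (P i).+1.
  rewrite -mulnDr -sum1_card -big_split -big_distrr /=.
  by under eq_bigr do rewrite addn1.
apply: leq_trans (leq_add (leqnn _) le_exp).
rewrite mulnA -sum1_card big_distrr -big_split /=.
by apply: leq_sum => i _; rewrite muln1 expn_log_le.
Qed.

(** A random subset of [X] contains [F] with probability 2^(-#|F|): adding [F] is a bijection from
    the subsets of [X :\: F]. *)
Lemma card_supersets (T : finType) (F X : {set T}) :
  F \subset X -> 2 ^ #|X| = 2 ^ #|F| * #|[set Y in powerset X | F \subset Y]|.
Proof.
move=> sFX.
have -> : #|[set Y in powerset X | F \subset Y]| = #|powerset (X :\: F)|.
  have -> : [set Y in powerset X | F \subset Y] =
            [set F :|: Y | Y in powerset (X :\: F)].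
    apply/setP=> Y; apply/idP/imsetP.
      rewrite !inE => /andP[sYX sFY]; exists (Y :\: F).
        by rewrite inE setSD.
      by rewrite setDE setUIr setUCr setIT; apply/esym/setUidPr.
    case=> Z; rewrite !inE => /subsetDP[sZX _] ->.
    by rewrite subUset sFX sZX subsetUl.
  rewrite card_in_imset // => Y Z; rewrite !inE.
  move=> /subsetDP[_ dY] /subsetDP[_ dZ] /(congr1 (fun S => S :\: F)).
  by rewrite !setDUl !setDv !set0U !(setDidPl _).
by rewrite card_powerset -expnD cardsDS // subnKC // subset_leq_card.
Qed.

(** * Information received by a node, and the general lower bound *)

Section LowerBound.
Variable ID : finType.
Implicit Types (G H : hypergraph ID) (u v w : ID).

Lemma partial_subset G (x : {set {set ID}}) e :
  e \in edges G :&: x -> e \subset verts G.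
Proof. by case/setIP=> /edges_subset. Qed.

Lemma partial_nonempty G (x : {set {set ID}}) e :
  e \in edges G :&: x -> e != set0.
Proof. by case/setIP=> /edges_nonempty. Qed.

(** All inputs share the vertices of [G], so the same algorithm and the same round count apply to
    every [x]. *)
Definition partial G (x : {set {set ID}}) : hypergraph ID :=
  Hypergraph (@partial_subset G x) (@partial_nonempty G x).

Lemma adjacent_partial G x w u : adjacent (partial G x) w u -> adjacent G w u.
Proof.
case/andP=> neq_wu /exists_inP[e /setIP[Ge _] we].
by rewrite /adjacent neq_wu; apply/exists_inP; exists e.
Qed.

Variables (msg out : finType) (A : algorithm ID msg out).

Definition received H (t : nat) v : ID -> option msg :=
  fun u => if adjacent H u v then send (pc_run A H t u) v else None.

Lemma pc_run_eq H H' (T : nat) v :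
  incident H v = incident H' v ->
  (forall t, t < T -> received H t v =1 received H' t v) ->
  pc_run A H T v = pc_run A H' T v.
Proof.
move=> eq_inc; elim: T => [|T IH] eq_rcv; first by rewrite /pc_run /= eq_inc.
have eqT : received H T v = received H' T v.
  by apply: boolp.funext; apply: eq_rcv.
rewrite /pc_run !iterS -!/(pc_run _ _ _) /pc_round -!/(received _ _ _) eqT.
by rewrite IH // => t lt_tT; apply: eq_rcv; apply: ltnW.
Qed.

Variables (G : hypergraph ID) (T : nat).

(** Indexed by the neighbours in [G] rather than in [partial G x], so that transcripts for different
    [x] have the same type; by [adjacent_partial] no message is missed. *)
Definition slot u : finType := ('I_T * {w : ID | adjacent G w u})%type.

Definition transcript u (x : {set {set ID}}) : {ffun slot u -> option msg} :=
  [ffun p : slot u => received (partial G x) p.1 u (val p.2)].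

Lemma pc_output_eq u x x' :
  incident (partial G x) u = incident (partial G x') u ->
  transcript u x = transcript u x' ->
  pc_output A (partial G x) T u = pc_output A (partial G x') T u.
Proof.
move=> eq_inc eq_tr; rewrite /pc_output; congr output.
apply: pc_run_eq => // t lt_tT w; have [Gwu | nGwu] := boolP (adjacent G w u).
  by have /ffunP/(_ (Ordinal lt_tT, Sub w Gwu)) := eq_tr; rewrite !ffunE.
rewrite /received; case: ifP => [/adjacent_partial | _].
  by rewrite (negPf nGwu).
by case: ifP => // /adjacent_partial; rewrite (negPf nGwu).
Qed.

Variables (J : {set out}) (F : out -> {set {set ID}}).

(** Edges through [u] are left out because [u] knows them from the start; only the others have to be
    learnt from messages. *)
Definition inferred u x : {set {set ID}} :=
  [set e : {set ID} | (u \notin e) &&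
     [exists o in J :&: pc_output A (partial G x) T u, e \in F o]].

Hypothesis F_present : forall u (x : {set {set ID}}) o,
  x \subset edges G -> u \in verts G -> o \in J ->
  o \in pc_output A (partial G x) T u -> F o \subset x.

Variable (b : nat).
Hypothesis msg_bits : #|{: option msg}| <= 2 ^ b.

(* A node cannot tell apart the hypergraphs that agree on its own edges and   *)
(* on its transcript [t], and the inferred edges lie in all of them: the pair *)
(* [t], [x :\: y] therefore determines [x] and the subset [y] of the inferred *)
(* edges.                                                                     *)
Lemma sum_exp_inferred u : u \in verts G ->
  \sum_(x in powerset (edges G)) 2 ^ #|inferred u x|
    <= 2 ^ (b * (T * #|[set w | adjacent G w u]|)) * #|powerset (edges G)|.
Proof.
move=> Gu.
have sPx (x : {set {set ID}}) : x \subset edges G -> inferred u x \subset x.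
  move=> sxG; apply/subsetP=> e; rewrite inE => /andP[_ /exists_inP[o]].
  by case/setIP=> Jo Oo; apply/subsetP/(F_present sxG Gu Jo Oo).
pose D := [set p : {set {set ID}} * {set {set ID}} |
             (p.1 \in powerset (edges G)) &&
             (p.2 \in powerset (inferred u p.1))].
have -> : \sum_(x in powerset (edges G)) 2 ^ #|inferred u x| = #|D|.
  rewrite -sum1dep_card.
  rewrite (eq_bigr (fun x => \sum_(y in powerset (inferred u x)) 1)).
    by rewrite pair_big_dep.
  by move=> x _; rewrite sum1_card card_powerset.
pose h p := (transcript u p.1, p.1 :\: p.2) :
  {ffun slot u -> option msg} * {set {set ID}}.
have h_inj : {in D &, injective h}.
  move=> [x y] [x' y']; rewrite !inE /= => /andP[sxG sy] /andP[sxG' sy'].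
  case=> eq_tr eq_D.
  (* Inferred edges avoid [u], so removing some of them leaves the initial knowledge of [u] readable
     from [z :\: y0]. *)
  have inc (z y0 : {set {set ID}}) :
      z \subset edges G -> y0 \subset inferred u z ->
      incident (partial G z) u = [set e : {set ID} in z :\: y0 | u \in e].
    move=> szG sy0; apply/setP=> e; rewrite !inE.
    have [ue | _] := boolP (u \in e); last by rewrite !andbF.
    rewrite !andbT; have [ez | _] := boolP (e \in z); last by rewrite !andbF.
    suff -> : e \notin y0 by rewrite (subsetP szG).
    by apply: contraL ue => /(subsetP sy0); rewrite inE => /andP[].
  have eqP : inferred u x = inferred u x'.
    rewrite /inferred (@pc_output_eq u x x') //.
    by rewrite (inc x y) // (inc x' y') // eq_D.
  have rec (z y0 : {set {set ID}}) :
      z \subset edges G -> y0 \subset inferred u z ->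
      z = (z :\: y0) :|: inferred u z.
    move=> szG sy0; apply/setP=> e; rewrite in_setU in_setD.
    have [Pe | nPe] := boolP (e \in inferred u z).
      by rewrite orbT (subsetP (sPx _ szG)).
    have -> : e \notin y0 by apply: contra nPe; apply: (subsetP sy0).
    by rewrite orbF.
  have eqx : x = x' by rewrite (rec x y) // (rec x' y') // eq_D eqP.
  have recy (z y0 : {set {set ID}}) :
      z \subset edges G -> y0 \subset inferred u z ->
      y0 = z :\: (z :\: y0).
    move=> szG sy0; rewrite setDDr setDv set0U.
    exact/esym/setIidPr/(subset_trans sy0)/sPx.
  by congr pair => //; rewrite (recy x y) // (recy x' y') // eq_D eqx.
rewrite -(card_in_imset h_inj).
pose messages := [set: {ffun slot u -> option msg}].
apply: (@leq_trans #|setX messages (powerset (edges G))|).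
  apply/subset_leq_card/subsetP=> _ /imsetP[[x y] + ->].
  rewrite !inE /= => /andP[sxG _]; exact: subset_trans (subsetDl _ _) sxG.
rewrite cardsX cardsT card_ffun card_prod card_ord card_sig.
rewrite leq_mul2r (expnM 2) [#|[set w | _]|]cardsE; apply/orP; right.
by case: (T * _) => // n; rewrite leq_exp2r.
Qed.

Lemma sum_inferred u : u \in verts G ->
  \sum_(x in powerset (edges G)) #|inferred u x|
    <= b * (T * #|[set w | adjacent G w u]|) * #|powerset (edges G)|.
Proof. by move=> Gu; apply/sum_le_log/sum_exp_inferred. Qed.

Variable (D : nat).
Hypothesis F_degree : forall e,
  e \in edges G -> #|[set o in J | e \in F o]| <= D.
Hypothesis F_no_common : forall o u,
  o \in J -> exists2 e, e \in F o & u \notin e.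

(** Each listed object has an edge avoiding [u], which is thereby inferred, and one edge accounts
    for at most [D] objects. *)
Lemma card_output u (x : {set {set ID}}) : x \subset edges G -> u \in verts G ->
  #|J :&: pc_output A (partial G x) T u| <= D * #|inferred u x|.
Proof.
move=> sxG Gu.
pose objects e := [set o in J | e \in F o].
apply: (@leq_trans #|\bigcup_(e in inferred u x) objects e|).
  apply/subset_leq_card/subsetP=> o Oo; have [Jo _] := setIP Oo.
  have [e Fe ue] := F_no_common u Jo.
  apply/bigcupP; exists e; last by rewrite inE Jo.
  by rewrite inE ue; apply/exists_inP; exists o.
rewrite mulnC -sum_nat_const.
apply: (@leq_trans (\sum_(e in inferred u x) #|objects e|)).
  elim/big_rec2: _ => [|e n B _ le_Bn]; first by rewrite cards0.
  by rewrite (leq_trans (leq_card_setU _ _)) ?leq_add2l.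
apply: leq_sum => e; rewrite inE => /andP[_ /exists_inP[o /setIP[Jo Oo] Fe]].
apply: F_degree; apply: (subsetP sxG).
exact: (subsetP (F_present sxG Gu Jo Oo)).
Qed.

End LowerBound.

(** Vertices outside the cover are isolated and receive nothing, so the total number of message
    slots per round depends on the cover and not on n. *)
Lemma sum_neighbours (ID : finType) (G : hypergraph ID) :
  \sum_(u in verts G) #|[set w | adjacent G w u]| <= #|cover (edges G)| ^ 2.
Proof.
set W := cover (edges G).
have -> : #|W| ^ 2 = \sum_(u in W) #|W| by rewrite sum_nat_const mulnn.
have nbr w u : adjacent G w u -> (w \in W) && (u \in W).
  case/andP=> _ /exists_inP[e Ge /andP[we ue]].
  by apply/andP; split; apply/bigcupP; exists e.
rewrite big_mkcond [leqRHS]big_mkcond; apply: leq_sum => u _.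
case: ifP => // _; case: ifP => [_ | nu].
  by apply/subset_leq_card/subsetP=> w; rewrite inE => /nbr/andP[].
rewrite leqn0 cards_eq0; apply/eqP/setP=> w; rewrite !inE.
by apply/negP => /nbr; rewrite nu andbF.
Qed.

Lemma enumeration_bound (ID msg out : finType) (A : algorithm ID msg out)
    (G : hypergraph ID) (T b c D : nat) (problem : hypergraph ID -> {set out})
    (J : {set out}) (F : out -> {set {set ID}}) :
  #|{: option msg}| <= 2 ^ b ->
  (forall x : {set {set ID}}, x \subset edges G ->
     pc_enumerates A (partial G x) T (problem (partial G x))) ->
  (forall o, o \in J -> F o \subset edges G /\ #|F o| <= c) ->
  (forall (x : {set {set ID}}) o, x \subset edges G -> o \in J ->
     (o \in problem (partial G x)) = (F o \subset x)) ->
  (forall e, e \in edges G -> #|[set o in J | e \in F o]| <= D) ->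
  (forall o u, o \in J -> exists2 e, e \in F o & u \notin e) ->
  #|J| <= 2 ^ c * D * (b * T) * #|cover (edges G)| ^ 2.
Proof.
move=> msg_bits enumA JF problemE degF commonF.
have F_present u (x : {set {set ID}}) o : x \subset edges G -> u \in verts G ->
    o \in J -> o \in pc_output A (partial G x) T u -> F o \subset x.
  move=> sxG Gu Jo Oo; rewrite -problemE //.
  by have [_ <-] := enumA x sxG; apply/bigcupP; exists u.
set m := #|powerset (edges G)|.
have m_gt0 : 0 < m by rewrite /m card_powerset expn_gt0.
rewrite -(leq_pmul2r m_gt0).
have objects_le (x : {set {set ID}}) : x \subset edges G ->
    #|[set o in J | F o \subset x]| <=
    \sum_(u in verts G) D * #|inferred A G T J F u x|.
  move=> sxG; have [_ cov] := enumA x sxG.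
  pose O u := J :&: pc_output A (partial G x) T u.
  apply: (@leq_trans (\sum_(u in verts G) #|O u|)).
    apply: (@leq_trans #|\bigcup_(u in verts G) O u|).
      apply/subset_leq_card/subsetP=> o /setIdP[Jo]; rewrite -problemE // -cov.
      by case/bigcupP=> u Gu Oo; apply/bigcupP; exists u; rewrite // inE Jo.
    elim/big_rec2: _ => [|u n B _ le_Bn]; first by rewrite cards0.
    by rewrite (leq_trans (leq_card_setU _ _)) ?leq_add2l.
  by apply: leq_sum => u Gu; apply: card_output.
(* Double counting of the pairs (o, x) with [F o \subset x]: each object lies in at least a fraction
   2^(-c) of the inputs. *)
have count : #|J| * m <=
    2 ^ c * \sum_(x in powerset (edges G)) #|[set o in J | F o \subset x]|.
  under eq_bigr do rewrite -sum1dep_card big_mkcondr.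
  rewrite exchange_big big_distrr -sum_nat_const; apply: leq_sum => o Jo.
  have [sFG Fc] := JF o Jo.
  rewrite /m card_powerset (card_supersets sFG) -big_mkcondr sum1dep_card.
  by rewrite leq_mul ?leq_pexp2l //.
apply: leq_trans count _; rewrite -!mulnA leq_mul2l; apply/orP; right.
apply: leq_trans (leq_sum _ _) _ => [x|].
  by rewrite inE => /objects_le; exact.
rewrite exchange_big /=; under eq_bigr do rewrite -big_distrr.
rewrite -big_distrr /= leq_mul2l; apply/orP; right.
apply: leq_trans (leq_sum _ _) _ => [u Gu|].
  exact: (sum_inferred F_present msg_bits Gu).
have -> : b * (T * (#|cover (edges G)| * (#|cover (edges G)| * m))) =
          b * T * m * #|cover (edges G)| ^ 2.
  by rewrite -mulnn -!mulnA [m * _]mulnC -!mulnA.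
rewrite /= -/m; under eq_bigr do rewrite mulnA mulnAC.
by rewrite -big_distrr leq_mul2l sum_neighbours orbT.
Qed.

(** * The hard family for simplices *)

Section Simplices.
Variables (ID : finType) (V W : {set ID}) (r : nat).
Hypotheses (sWV : W \subset V) (r_gt0 : 0 < r).

Let uniform_edges : {set {set ID}} :=
  [set e : {set ID} | e \subset W & #|e| == r].

Lemma uniform_subset e : e \in uniform_edges -> e \subset V.
Proof. by rewrite inE => /andP[/subset_trans-> //]. Qed.

Lemma uniform_nonempty e : e \in uniform_edges -> e != set0.
Proof. by rewrite inE -card_gt0 => /andP[_ /eqP->]. Qed.

Definition complete_uniform : hypergraph ID :=
  Hypergraph uniform_subset uniform_nonempty.

Lemma complete_uniform_size :
  \sum_(e in edges complete_uniform) #|e| = r * 'C(#|W|, r).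
Proof.
rewrite -cards_draws mulnC -sum_nat_const.
by apply: eq_bigr => e; rewrite inE => /andP[_ /eqP].
Qed.

(** A simplex is encoded by its r + 1 facets, whence c = r + 1. A facet extends to a simplex by one
    vertex of [W], whence D = #|W|, which joins the squared cover to give the cube. *)
Lemma complete_uniform_bound (msg : finType)
    (A : algorithm ID msg (vertex_set ID)) (T b : nat)
    (problem : hypergraph ID -> {set vertex_set ID}) :
  #|{: option msg}| <= 2 ^ b ->
  (forall H (S : {set ID}),
     #|S| = r.+1 -> (S \in problem H) = is_simplex H r S) ->
  (forall x : {set {set ID}}, x \subset edges complete_uniform ->
     pc_enumerates A (partial complete_uniform x) T
       (problem (partial complete_uniform x))) ->
  'C(#|W|, r.+1) <= 2 ^ r.+1 * (b * T) * #|W| ^ 3.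
Proof.
move=> msg_bits problemE enumA.
pose J : {set vertex_set ID} := [set S : {set ID} | S \subset W & #|S| == r.+1].
pose F (S : vertex_set ID) := [set e : {set ID} | e \subset S & #|e| == r].
have /(_ #|W|) :=
  enumeration_bound (J := J) (F := F) (c := r.+1) msg_bits enumA.
rewrite {1}/J cards_draws => bound; apply: leq_trans (bound _ _ _ _) _.
- move=> S; rewrite inE => /andP[sSW /eqP cS]; split.
    apply/subsetP=> e; rewrite !inE => /andP[/subset_trans-> //].
  by rewrite cards_draws cS -bin_sub // subSnn bin1.
- move=> x S sxG; rewrite inE => /andP[sSW /eqP cS].
  rewrite problemE // /is_simplex cS eqxx (subset_trans sSW sWV) /=.
  apply/forallP/subsetP => [simp e | sFx e].
    by rewrite inE => Se; have /implyP/(_ Se)/setIP[] := simp e.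
  apply/implyP=> Se; have xe: e \in x by apply: sFx; rewrite inE.
  by rewrite inE xe (subsetP sxG).
- move=> e; rewrite inE => /andP[_ /eqP ce].
  apply: (@leq_trans #|[set w |: e | w in W]|); last exact: leq_imset_card.
  apply/subset_leq_card/subsetP=> S; rewrite !inE.
  move=> /andP[/andP[sSW /eqP cS] /andP[seS _]].
  have /cards1P[w Sw] : #|S :\: e| == 1 by rewrite cardsDS // cS ce subSnn.
  have /setDP[Sw' _] : w \in S :\: e by rewrite Sw set11.
  apply/imsetP; exists w; first exact: (subsetP sSW).
  by rewrite -Sw -{1}(setID S e) (setIidPr seS) setUC.
- move=> S u; rewrite inE => /andP[_ /eqP cS].
  (* Take w = u if [u] lies in [S], and any vertex of [S] otherwise: the facet [S :\ w] then avoids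
     [u]. *)
  have [w Sw uw] : exists2 w, w \in S & (u \in S) ==> (u == w).
    have [Su | nSu] := boolP (u \in S); first by exists u => /=.
    by have /card_gt0P[w Sw] : 0 < #|S| by [rewrite cS]; exists w.
  exists (S :\ w).
    by rewrite inE subD1set -eqSS -cS (cardsD1 w S) Sw eqxx.
  by rewrite !inE andbC negb_and negbK -implybE.
have coverW : #|cover (edges complete_uniform)| <= #|W|.
  by apply/subset_leq_card/bigcupsP => e; rewrite inE => /andP[].
rewrite (expnS _ 2) -!mulnA leq_mul2l (mulnCA #|W|) (mulnCA #|W| T).
by rewrite !leq_mul2l leq_exp2r // coverW !orbT.
Qed.

End Simplices.

(** * The hard family for triangles *)

Section Triangles.
Variables (ID : finType) (V : {set ID}) (s : nat).
Variable g : 'I_3 * option 'I_s -> ID.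
Hypotheses (g_inj : injective g) (gV : forall p, g p \in V).
Implicit Types (i j : 'I_3) (Y : {set 'I_s}).
Local Open Scope ring_scope.

(** The injection [g] places all special vertices at once: (i, None) is the corner v_i, and the (i,
    Some y) form the set X_i. *)
Let corner i := g (i, None).

Definition side i Y : {set ID} :=
  corner i |: (corner (i + 1) |: [set g (i, Some y) | y in Y]).

Lemma corner_side j i Y : (corner j \in side i Y) = (j == i) || (j == i + 1).
Proof.
rewrite !inE !(inj_eq g_inj) !xpair_eqE !andbT.
case: imsetP; last by rewrite orbF.
by case=> y _ /g_inj.
Qed.

Lemma inner_side j (y : 'I_s) i Y :
  (g (j, Some y) \in side i Y) = (j == i) && (y \in Y).
Proof.
rewrite !inE !(inj_eq g_inj) !xpair_eqE !andbF /=.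
apply/imsetP/andP => [[z Yz /g_inj[-> ->]] // | [/eqP-> Yy]]; by exists y.
Qed.

Lemma I3_neq i : ((i == i + 1) = false) * ((i == i + 1 + 1) = false) *
  ((i + 1 == i) = false) * ((i + 1 + 1 == i) = false).
Proof. by case: i => [[|[|[|]]]]. Qed.

(** The two corners in a side determine its index, since i and i + 1 are the only corner indices in
    side i and 3 > 2; the inner vertices then determine the subset. *)
Lemma side_inj i j Y Z : side i Y = side j Z -> i = j /\ Y = Z.
Proof.
move=> eqYZ; have eq_ij : i = j.
  have := corner_side i j Z; rewrite -eqYZ corner_side eqxx /=.
  move=> /esym/orP[/eqP // | /eqP ij].
  have := corner_side (i + 1) j Z; rewrite -eqYZ corner_side eqxx orbT ij.
  by rewrite (inj_eq (GRing.addIr _)) !I3_neq.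
split=> //; apply/setP=> y.
by have := inner_side i y i Y; rewrite eqYZ inner_side eq_ij eqxx.
Qed.

(** A vertex with index j, corner or inner, is missed by side j + 1, whose corners are j + 1 and j +
    2. *)
Lemma no_common_vertex (Y : 'I_3 -> {set 'I_s}) u :
  exists i, u \notin side i (Y i).
Proof.
have [/existsP[[j o] /eqP->] | /existsPn nu] := boolP [exists p, u == g p].
  exists (j + 1); case: o => [y|]; first by rewrite inner_side I3_neq.
  by rewrite -/(corner j) corner_side !I3_neq.
exists 0; apply/negP; rewrite !inE.
move=> /or3P[/eqP eu | /eqP eu | /imsetP[y _ eu]].
- by have := nu (0, None); rewrite eu eqxx.
- by have := nu (0 + 1, None); rewrite eu eqxx.
- by have := nu (0, Some y); rewrite eu eqxx.
Qed.

Let side_edges : {set {set ID}} := [set side p.1 p.2 | p : 'I_3 * {set 'I_s}].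

Lemma side_subset e : e \in side_edges -> e \subset V.
Proof.
case/imsetP=> -[i Y] _ ->; rewrite !subUset !sub1set !gV.
by apply/subsetP=> _ /imsetP[y _ ->].
Qed.

Lemma side_nonempty e : e \in side_edges -> e != set0.
Proof.
case/imsetP=> -[i Y] _ ->; apply/set0Pn; exists (corner i); exact: setU11.
Qed.

Definition side_hypergraph : hypergraph ID :=
  Hypergraph side_subset side_nonempty.

Lemma side_hypergraph_size :
  (\sum_(e in edges side_hypergraph) #|e| <= 3 * 2 ^ s * (s + 2))%N.
Proof.
apply: (@leq_trans (\sum_(e in edges side_hypergraph) (s + 2))).
  apply: leq_sum => _ /imsetP[[i Y] _ ->].
  rewrite addnC; apply: leq_trans (leq_card_setU _ _) _.
  rewrite cards1 leq_add2l; apply: leq_trans (leq_card_setU _ _) _.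
  rewrite cards1 leq_add2l (leq_trans (leq_imset_card _ _)) //.
  by rewrite -[leqRHS]card_ord max_card.
rewrite sum_nat_const leq_mul2r (leq_trans (leq_imset_card _ _)) ?orbT //.
by rewrite card_prod card_ord -cardsT -powersetT card_powerset cardsT card_ord.
Qed.

Lemma card_cover_side : (#|cover (edges side_hypergraph)| <= 3 * s.+1)%N.
Proof.
have <- : #|{: 'I_3 * option 'I_s}| = (3 * s.+1)%N.
  by rewrite card_prod card_option !card_ord.
apply: (@leq_trans #|[set g p | p in [set: 'I_3 * option 'I_s]]|).
  apply/subset_leq_card/bigcupsP=> _ /imsetP[[i Y] _ ->].
  rewrite !subUset !sub1set /corner !imset_f ?inE //=.
  by apply/subsetP=> _ /imsetP[y _ ->]; apply: imset_f.
by rewrite -cardsT leq_imset_card.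
Qed.

Definition side_triangle (Y : {ffun 'I_3 -> {set 'I_s}}) : cycle3 ID :=
  ([ffun i => corner i], [ffun i => side i (Y i)]).

Lemma side_triangle_inj : injective side_triangle.
Proof.
move=> Y Z [] /ffunP eqYZ; apply/ffunP=> i.
by have := eqYZ i; rewrite !ffunE => /side_inj[].
Qed.

(** There are (2^s)^3 triangles, and fixing one side leaves D = (2^s)^2 of them, so a factor 2^s
    survives. Every [side_triangle] is induced, which is why the assumption on [problem] covers both
    enumeration problems. *)
Lemma side_hypergraph_bound (msg : finType) (A : algorithm ID msg (cycle3 ID))
    (T b : nat) (problem : hypergraph ID -> {set cycle3 ID}) :
  (#|{: option msg}| <= 2 ^ b)%N ->
  (forall H (t : cycle3 ID), [forall i, t.1 i \notin t.2 (i + 1)] ->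
     (t \in problem H) = (t \in triangles H)) ->
  (forall x : {set {set ID}}, x \subset edges side_hypergraph ->
     pc_enumerates A (partial side_hypergraph x) T
       (problem (partial side_hypergraph x))) ->
  (2 ^ s <= 2 ^ 3 * (b * T) * (3 * s.+1) ^ 2)%N.
Proof.
move=> msg_bits problemE enumA.
pose J : {set cycle3 ID} :=
  [set side_triangle Y | Y in [set: {ffun 'I_3 -> {set 'I_s}}]].
pose F (t : cycle3 ID) := [set t.2 i | i in [set: 'I_3]].
have card_subsets : #|{: {set 'I_s}}| = (2 ^ s)%N.
  by rewrite -cardsT -powersetT card_powerset cardsT card_ord.
have /(_ ((2 ^ s) ^ 2)%N) :=
  enumeration_bound (J := J) (F := F) (c := 3) msg_bits enumA.
rewrite {1}/J card_imset; last exact: side_triangle_inj.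
rewrite cardsT card_ffun card_ord card_subsets => bound.
have {bound} le_bound : (2 ^ s * (2 ^ s) ^ 2 <= 2 ^ 3 * (2 ^ s) ^ 2 * (b * T) *
   #|cover (edges side_hypergraph)| ^ 2)%N.
  rewrite -expnS; apply: bound.
  - move=> _ /imsetP[Y _ ->]; split.
      apply/subsetP=> _ /imsetP[i _ ->]; rewrite ffunE.
      by apply/imsetP; exists (i, Y i).
    by rewrite (leq_trans (leq_imset_card _ _)) // cardsT card_ord.
  - move=> x _ sxG /imsetP[Y _ ->].
    rewrite problemE; last first.
      by apply/forallP=> i; rewrite !ffunE corner_side !I3_neq.
    rewrite inE; apply/idP/subsetP => [|sFx].
      move=> /and5P[_ _ _ /forallP Ex _] _ /imsetP[i _ ->].
      by have := Ex i; rewrite inE => /andP[].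
    have Fi i : (side_triangle Y).2 i \in F (side_triangle Y) by apply: imset_f.
    apply/and5P; split.
    + by apply/injectiveP=> i j; rewrite !ffunE => /g_inj[].
    + by apply/injectiveP=> i j; rewrite !ffunE => /side_inj[].
    + by apply/forallP=> i; rewrite ffunE gV.
    + by apply/forallP=> i; rewrite inE sFx ?Fi // (subsetP sxG) ?sFx ?Fi.
    + apply/forallP=> i; rewrite inE !ffunE !corner_side.
      by rewrite GRing.subrK !eqxx orbT.
  - move=> _ /imsetP[[i0 Y0] _ ->] /=.
    (* A triangle through the side (i0, Y0) is recovered from its subsets at the two other
       indices. *)
    pose h (p : {set 'I_s} * {set 'I_s}) := side_triangle
      [ffun i => if i == i0 then Y0 else if i == i0 + 1 then p.1 else p.2].
    pose pairs := [set: {set 'I_s} * {set 'I_s}].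
    apply: (@leq_trans #|[set h p | p in pairs]|); last first.
      rewrite (leq_trans (leq_imset_card _ _)) //.
      by rewrite cardsT card_prod card_subsets mulnn.
    apply/subset_leq_card/subsetP=> t /setIdP[/imsetP[Y _ ->] /imsetP[i _]].
    rewrite ffunE => /side_inj[eq_i eq_Y].
    apply/imsetP; exists (Y (i0 + 1), Y (i0 + 1 + 1)) => //.
    rewrite /h eq_Y -eq_i; congr side_triangle; apply/ffunP=> j.
    rewrite ffunE /=; case: eqP => [-> // | /eqP ji].
    case: eqP => [-> // | /eqP ji1]; congr (Y _).
    apply/eqP; move: ji ji1.
    by case: (i0) => [[|[|[|]]]] //; case: j => [[|[|[|]]]].
  - move=> _ u /imsetP[Y _ ->]; have [i ui] := no_common_vertex Y u.
    by exists (side i (Y i)) => //; apply/imsetP; exists i; rewrite ?ffunE.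
have e_gt0 : (0 < (2 ^ s) ^ 2)%N by rewrite !expn_gt0.
rewrite -(leq_pmul2r e_gt0) (leq_trans le_bound) //.
rewrite [leqRHS]mulnAC [(_ * (b * T) * (2 ^ s) ^ 2)%N]mulnAC.
by rewrite leq_mul2l leq_exp2r // card_cover_side orbT.
Qed.

End Triangles.

(* Total size O(q^r) on O(q) non-isolated vertices forces Omega(q^(r-3) / b)  *)
(* rounds.                                                                    *)
Definition hard (out : finType -> finType)
    (problem : forall ID : finType, hypergraph ID -> {set out ID})
    (r L K : nat) :=
  forall (ID : finType) (V : {set ID}) (q : nat), 0 < q -> L * q <= #|V| ->
  exists G : hypergraph ID,
  [/\ verts G = V, \sum_(e in edges G) #|e| <= L * q ^ r &
    forall (msg : finType) (A : algorithm ID msg (out ID)) (T b : nat),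
      #|{: option msg}| <= 2 ^ b ->
      (forall x : {set {set ID}}, x \subset edges G ->
        pc_enumerates A (partial G x) T (problem ID (partial G x))) ->
      q ^ r <= K * q ^ 3 * (b * T)].

(** * Tuning both families to the parameter q *)

Lemma bin_le_expn n m : 'C(n, m) <= n ^ m.
Proof.
rewrite (leq_trans (leq_pmulr _ (fact_gt0 m))) // bin_ffact ffact_prod.
rewrite -[X in _ <= _ ^ X]card_ord -prod_nat_const.
by apply: leq_prod => i _; apply: leq_subr.
Qed.

Lemma simplices_hard
    (problem : forall ID : finType, hypergraph ID -> {set vertex_set ID})
    (r : nat) :
  0 < r ->
  (forall ID (H : hypergraph ID) (S : {set ID}), #|S| = r.+1 ->
     (S \in problem ID H) = is_simplex H r S) ->
  exists L K, hard (out := vertex_set) problem r L K.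
Proof.
move=> r_gt0 problemE.
exists (r.+1 * r.+1 ^ r), (r.+1`! * 2 ^ r.+1 * r.+1 ^ 3) => ID V q q_gt0 le_V.
(* With q + r vertices in [W], each of the r + 1 factors of the falling factorial is at least q, so
   the number of simplices is at least q^(r+1) / (r+1)!. *)
have le_N : q + r <= r.+1 * q by rewrite mulSn leq_add2l leq_pmulr.
have /card_geqP[W [uW cW sW]] : q + r <= #|V|.
  rewrite (leq_trans le_N) // (leq_trans _ le_V) // leq_mul2r.
  by rewrite leq_pmulr ?orbT // expn_gt0.
have cardW : #|[set w in W]| = q + r by rewrite cardsE (card_uniqP uW).
have sWV : [set w in W] \subset V by apply/subsetP=> w; rewrite inE => /sW.
exists (complete_uniform sWV r_gt0); split=> //.
  rewrite complete_uniform_size cardW -mulnA -expnMn.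
  by rewrite leq_mul // (leq_trans (bin_le_expn _ _)) // leq_exp2r.
move=> msg A T b msg_bits enumA.
have bound := complete_uniform_bound msg_bits (problemE ID) enumA.
rewrite cardW in bound.
have lower : q ^ r.+1 <= r.+1`! * 'C(q + r, r.+1).
  rewrite mulnC bin_ffact ffact_prod -[X in _ ^ X <= _]card_ord -prod_nat_const.
  by apply: leq_prod => i _; rewrite -addnBA ?leq_addr // -ltnS.
(* A spare factor q is given up here, to reach the form shared with triangles. *)
rewrite (@leq_trans (q ^ r.+1)) //; first by rewrite expnS leq_pmull.
have -> : r.+1`! * 2 ^ r.+1 * r.+1 ^ 3 * q ^ 3 * (b * T) =
          r.+1`! * (2 ^ r.+1 * (b * T) * (r.+1 * q) ^ 3).
  by rewrite expnMn; ring.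
rewrite (leq_trans lower) // leq_mul2l (leq_trans bound) ?orbT //.
by rewrite leq_mul2l leq_exp2r // le_N orbT.
Qed.

(** Choose 2^s of order q^(r-1): at most 3 2^s edges of size at most s + 2 = O(q) have total size
    O(q^r). Multiplying the bound on 2^s by q gives q^r on the left; on the right, the crude s + 1 =
    O(q) turns q (s + 1)^2 into O(q^3). *)
Lemma triangles_hard
    (problem : forall ID : finType, hypergraph ID -> {set cycle3 ID})
    (r : nat) :
  0 < r ->
  (forall ID (H : hypergraph ID) (t : cycle3 ID),
     [forall i, t.1 i \notin t.2 (i + 1)%R] ->
     (t \in problem ID H) = (t \in triangles H)) ->
  exists L K, hard (out := cycle3) problem r L K.
Proof.
case: r => // r _ problemE.
exists (3 * 2 * r.+1), (2 * (2 ^ 3 * (3 * r.+1) ^ 2)) => ID V q q_gt0 le_V.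
pose s := trunc_log 2 (q ^ r).
have qr_gt0 : 0 < q ^ r by rewrite expn_gt0 q_gt0.
have [s_le s_gt] : 2 ^ s <= q ^ r /\ q ^ r < 2 ^ s.+1.
  by split; [exact: trunc_logP | exact: trunc_log_ltn].
have le_s : s.+1 <= q * r.+1.
  rewrite mulnS -add1n leq_add // -(@leq_exp2l 2) // (leq_trans s_le) // expnM.
  by case: (r) => // r'; rewrite leq_exp2r // ltnW // ltn_expl.
have card_I : #|{: 'I_3 * option 'I_s}| <= #|V|.
  rewrite card_prod card_option !card_ord (leq_trans _ le_V) //.
  rewrite -!mulnA leq_mul2l /= (leq_trans le_s) // mulnC.
  by rewrite leq_pmull.
pose g p : ID := enum_val (widen_ord card_I (enum_rank p)).
have g_inj : injective g.
  by move=> p p' /enum_val_inj/(congr1 val)/= /val_inj/enum_rank_inj.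
have gV p : g p \in V by apply: enum_valP.
exists (side_hypergraph gV); split=> //.
  rewrite (leq_trans (side_hypergraph_size gV)) // expnS.
  have -> : 3 * 2 * r.+1 * (q * q ^ r) = 3 * q ^ r * (2 * (q * r.+1)) by ring.
  apply: leq_mul; first by rewrite leq_mul2l.
  rewrite (@leq_trans (2 * s.+1)) ?leq_mul2l ?le_s ?orbT //.
  by rewrite mul2n -addnn addn2 addSn ltnS leq_addl.
move=> msg A T b msg_bits enumA.
have bound := side_hypergraph_bound g_inj msg_bits (problemE ID) enumA.
rewrite expnS (leq_trans (leq_mul (leqnn q) (ltnW s_gt))) //.
have -> : 2 * (2 ^ 3 * (3 * r.+1) ^ 2) * q ^ 3 * (b * T) =
          q * (2 * (2 ^ 3 * (b * T) * (3 * (q * r.+1)) ^ 2)).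
  by ring.
rewrite leq_mul2l expnS leq_mul2l /= (leq_trans bound) ?orbT //.
by rewrite leq_mul2l leq_exp2r // leq_mul2l le_s !orbT.
Qed.

From mathcomp Require Import all_classical all_reals all_analysis.

Import Order.TTheory GRing.Theory Num.Theory.
Import numFieldNormedType.Exports.

Local Open Scope classical_set_scope.
Local Open Scope ring_scope.

(** * Passage to the asymptotic bound *)

Section Asymptotics.
Variables (R : realType) (eps : R).
Hypothesis eps_gt0 : 0 < eps.

(** Take q to be the integer part of the r-th root y of x; then y < q + 1 <= 2 q. *)
Lemma exists_root (x : R) (r : nat) : (0 < r)%N -> 1 <= x ->
  exists2 q : nat, (0 < q)%N & q%:R ^+ r <= x <= 2 ^+ r * q%:R ^+ r.
Proof.
move=> r_gt0 x_ge1; have x_ge0 : 0 <= x by apply: le_trans x_ge1.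
pose y := x `^ r%:R^-1; have y_ge0 : 0 <= y by apply: powR_ge0.
have yr : y ^+ r = x.
  by rewrite -powR_mulrn // -powRrM mulVf ?powRr1 // pnatr_eq0 -lt0n.
have q_gt0 : (0 < Num.truncn y)%N.
  rewrite truncn_gt0; apply: (@le_trans _ _ (1 `^ r%:R^-1)).
    by rewrite powR1.
  by rewrite ge0_ler_powR ?nnegrE ?invr_ge0.
exists (Num.truncn y) => //.
rewrite -exprMn -{1 2}yr !lerXn2r ?nnegrE ?truncn_le //.
rewrite (le_trans (ltW (truncnS_gt y))) // -natrM ler_nat.
by rewrite mul2n -addnn -addn1 leq_add2l.
Qed.

(** Write ln n as (2/eps) ln(n^(eps/2)) and use ln z < z. *)
Lemma ln_le_powR (n : nat) :
  (0 < n)%N -> ln (n%:R : R) <= 2 / eps * n%:R `^ (eps / 2).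
Proof.
move=> n_gt0; have e2 : 0 < eps / 2 by rewrite divr_gt0.
rewrite -[2 / eps]invf_div ler_pdivlMl // -ln_powR ltW // ln_sublinear //.
by rewrite powR_gt0 // ltr0n.
Qed.

Lemma eventually_bits (B : nat -> nat) :
  ((fun n => (B n)%:R) : nat -> R^o)
    \is 'Theta_\oo ((fun n => ln n%:R) : nat -> R^o) ->
  exists2 b : R, 0 < b &
    \forall n \near \oo, (B n).+1%:R <= b * n%:R `^ (eps / 2).
Proof.
rewrite bigThetaE => -[/eqO_exP[k k_gt0 Bk] _].
exists (1 + k * (2 / eps)).
  by rewrite addr_gt0 // mulr_gt0 // divr_gt0.
near=> n; have n_gt0 : (0 < n)%N by near: n; exact: nbhs_infty_gt.
have n_ge1 : 1 <= n%:R :> R by rewrite ler1n.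
have : `|(B n)%:R : R| <= k * `|ln n%:R : R| by near: n.
rewrite normr_nat ger0_norm ?ln_ge0 // => le_B.
rewrite -natr1 addrC mulrDl mul1r lerD //.
  by rewrite -[leLHS](powRr0 n%:R) ler_powR // divr_ge0 // ltW.
by rewrite (le_trans le_B) // -mulrA ler_wpM2l ?ln_le_powR // ltW.
Unshelve. all: by end_near. Qed.

(** Half of eps absorbs q^3 = (q^r)^(3/r), the other half absorbs the message length. What remains
    of c n <= 2^r q^r is a bound on [T n]. *)
Lemma hard_requires (C : R) (k B : nat -> nat) (out : finType -> finType)
    (problem : forall ID : finType, hypergraph ID -> {set out ID})
    (r L K : nat) :
  0 < C -> (forall n, n <= 2 ^ k n)%N ->
  ((fun n => (B n)%:R) : nat -> R^o)
    \is 'Theta_\oo ((fun n => ln n%:R) : nat -> R^o) ->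
  6 / eps <= r%:R -> hard problem r L K ->
  pc_enumeration_requires C k B problem (fun n => n%:R `^ (1 - eps)).
Proof.
move=> C_gt0 k_ge /eventually_bits[b b_gt0 Bb] r_ge hardP T A enumA.
have r_gt0 : (0 < r)%N.
  by rewrite -(ltr0n R) (lt_le_trans _ r_ge) // divr_gt0.
(* With q^r <= c n, the inequality L c <= C gives sparsity and L c <= 1 gives enough vertices;
   [L.+1] keeps the denominator positive. *)
pose c : R := Num.min C 1 / L.+1%:R.
have c_gt0 : 0 < c by rewrite divr_gt0 // lt_min C_gt0 ltr01.
have c_le : L%:R * c <= C /\ L%:R * c <= 1.
  have le_min : L%:R * c <= Num.min C 1.
    rewrite /c mulrA ler_pdivrMr // mulrC ler_wpM2l ?ler_nat //.
    by rewrite le_min !ltW.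
  by split; rewrite (le_trans le_min) // ge_min lexx ?orbT.
pose M : R := 2 ^+ r * K.+1%:R * b.
have M_gt0 : 0 < M by rewrite !mulr_gt0 // exprn_gt0.
rewrite qualifE; apply/asboolP; exists (c / M); first by rewrite divr_gt0.
near=> n; rewrite normr_nat ger0_norm ?powR_ge0 //.
have n_gt0 : (0 < n)%N by near: n; exact: nbhs_infty_gt.
have n_ge1 : 1 <= n%:R :> R by rewrite ler1n.
have cn_ge1 : 1 <= c * n%:R.
  by rewrite -ler_pdivrMl // mulr1; near: n; exact: nbhs_infty_ger.
have Bn : (B n).+1%:R <= b * n%:R `^ (eps / 2) by near: n.
have [q q_gt0 /andP[q_le q_ge]] := exists_root r_gt0 cn_ge1.
have Lq_le : L%:R * q%:R ^+ r <= L%:R * c * n%:R :> R.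
  by rewrite -mulrA ler_wpM2l.
have /card_geqP[s [s_uniq s_size _]] : (n <= #|{: (k n).-tuple bool}|)%N.
  by rewrite card_tuple card_bool.
pose V : {set (k n).-tuple bool} := [set v in s]%SET.
have cardV : #|V| = n by rewrite cardsE (card_uniqP s_uniq).
have Lq_V : (L * q <= #|V|)%N.
  rewrite cardV -(ler_nat R) natrM.
  apply: (@le_trans _ _ (L%:R * q%:R ^+ r)).
    rewrite ler_wpM2l // -{1}[q%:R]expr1.
    by rewrite ler_weXn2l // ler1n.
  rewrite (le_trans Lq_le) // -[leRHS]mul1r ler_wpM2r //.
  by case: c_le.
have [G [vertsG sizeG boundG]] := hardP _ V q q_gt0 Lq_V.
(* The extra bit accommodates [None]: 2^B + 1 <= 2^(B+1). *)
have msg_bits : (#|{: option ((B n).-tuple bool)}| <= 2 ^ (B n).+1)%N.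
  rewrite card_option card_tuple card_bool expnS mul2n -addnn -addn1.
  by rewrite leq_add2l expn_gt0.
have qT : (q ^ r <= K * q ^ 3 * ((B n).+1 * T n))%N.
  apply: (boundG _ (A n) _ _ msg_bits) => x _.
  apply: enumA; first by rewrite vertsG.
  rewrite /sparse /= vertsG cardV.
  apply: (@le_trans _ _ (L%:R * q%:R ^+ r)).
    rewrite -natrX -natrM ler_nat (leq_trans _ sizeG) //.
    by rewrite [leqRHS](big_setID x) leq_addr.
  by rewrite (le_trans Lq_le) // ler_wpM2r //; case: c_le.
have q3 : q%:R ^+ 3 <= n%:R `^ (eps / 2) :> R.
  have r_neq0 : r%:R != 0 :> R by rewrite pnatr_eq0 -lt0n.
  have -> : q%:R ^+ 3 = (q%:R ^+ r) `^ (3 / r%:R) :> R.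
    by rewrite -!powR_mulrn // -powRrM mulrCA divff // mulr1.
  apply: (@le_trans _ _ (n%:R `^ (3 / r%:R))).
    rewrite ge0_ler_powR ?nnegrE ?divr_ge0 ?exprn_ge0 //.
    rewrite (le_trans q_le) // -[leRHS]mul1r ler_wpM2r //.
    by rewrite ler_pdivrMr // mul1r (@le_trans _ _ 1) ?ler1n // ge_min lexx orbT.
  rewrite ler_powR // ler_pdivrMr ?ltr0n //.
  by move: r_ge; rewrite ler_pdivrMr // => r_ge; lra.
have cT : c * n%:R <= M * n%:R `^ eps * (T n)%:R.
  apply: (le_trans q_ge).
  have -> : M * n%:R `^ eps * (T n)%:R =
      2 ^+ r * (K.+1%:R * n%:R `^ (eps / 2) *
                (b * n%:R `^ (eps / 2) * (T n)%:R)).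
    rewrite [in LHS](splitr eps) powRD; first by rewrite /M; ring.
    by rewrite pnatr_eq0 -lt0n n_gt0 implybT.
  rewrite ler_wpM2l ?exprn_ge0 //.
  have : q%:R ^+ r <= K%:R * q%:R ^+ 3 * ((B n).+1%:R * (T n)%:R) :> R.
    by rewrite -!natrX -!natrM ler_nat.
  move=> /le_trans; apply.
  by rewrite !ler_pM ?mulr_ge0 ?exprn_ge0 ?ler_nat.
rewrite powRB ?powRr1 //; last by rewrite pnatr_eq0 -lt0n n_gt0 implybT.
have ne_gt0 : 0 < n%:R `^ eps :> R by rewrite powR_gt0 // ltr0n.
rewrite mulf_div ler_pdivrMr ?mulr_gt0 //.
by rewrite [leRHS]mulrC.
Unshelve. all: by end_near. Qed.

End Asymptotics.

Theorem theorem39 (R : realType) (eps : R) (eps_gt0 : 0 < eps) :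
  exists2 r : nat, (2 <= r)%N &
  forall (C : R) (k B : nat -> nat),
    0 < C ->
    (forall n, n <= 2 ^ k n)%N ->
    ((fun n => (k n)%:R) : nat -> R^o) =O_\oo ((fun n => ln n%:R) : nat -> R^o) ->
    ((fun n => (B n)%:R) : nat -> R^o) \is 'Theta_\oo ((fun n => ln n%:R) : nat -> R^o) ->
    let lower_bound := fun n : nat => n%:R `^ (1 - eps) in
    [/\ pc_enumeration_requires C k B (@triangles) lower_bound,
        pc_enumeration_requires C k B (@induced_triangles) lower_bound,
        pc_enumeration_requires C k B (fun ID => @simplices ID r) lower_bound &
        pc_enumeration_requires C k B (@all_simplices) lower_bound].
Proof.
(* This r is both the exponent in [hard] and the dimension of the simplices. The two successors
   round 6/eps up and ensure r >= 2, so that [all_simplices] agrees with [simplices r] on sets of r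
   + 1 vertices. *)
pose r := (Num.truncn (6 / eps)).+2.
have r_ge : 6 / eps <= r%:R.
  by rewrite (le_trans (ltW (truncnS_gt _))) // ler_nat.
exists r => // C k B C_gt0 k_ge _ B_Theta lower_bound.
have [L1 [K1 hard1]] : exists L K, hard (@triangles) r L K.
  by apply: triangles_hard.
have [L2 [K2 hard2]] : exists L K, hard (@induced_triangles) r L K.
  by apply: triangles_hard => // ID H t t_ind; rewrite inE t_ind andbT.
have [L3 [K3 hard3]] : exists L K, hard (fun ID => @simplices ID r) r L K.
  by apply: simplices_hard => // ID H S _; rewrite inE.
have [L4 [K4 hard4]] : exists L K, hard (@all_simplices) r L K.
  by apply: simplices_hard => // ID H S cS; rewrite inE cS.
split.
- exact: (hard_requires eps_gt0 C_gt0 k_ge B_Theta r_ge hard1).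
- exact: (hard_requires eps_gt0 C_gt0 k_ge B_Theta r_ge hard2).
- exact: (hard_requires eps_gt0 C_gt0 k_ge B_Theta r_ge hard3).
- exact: (hard_requires eps_gt0 C_gt0 k_ge B_Theta r_ge hard4).
Qed.
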